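(* Greedy Approval Voting (GAV) satisfies weak unanimity: on every attribute-approval instance, every committee output by GAV (however ties are broken) satisfies weak unanimity.
   Context: Attribute-approval instance: a finite nonempty set of voters $V=\{v_1,\dots,v_n\}$, a finite set of candidates $C=\{c_1,\dots,c_m\}$, a number of dimensions $d\ge 1$, and a target committee size $1\le k\le m$. Each candidate $c$ has a vector of attribute values $(c[1],\dots,c[d])$ with $c[j]\in D^j$, where $D^j$ is a finite domain; every value in $D^j$ is the value $c[j]$ of at least one candidate $c\in C$ (different candidates may share values). Each voter $v_i$ submits, for every $j\in\{1,\dots,d\}$, a set $C_i^j\subseteq D^j$ of approved values. A committee is a subset $W\subseteq C$ with $|W|=k$, and $W^j=\{c[j]: c\in W\}$. For a set of voters $U\subseteq V$ put $U_{c[j]}=\{v_i\in U: c[j]\in C_i^j\}$. Greedy Approval Voting (GAV): start with $W=\emptyset$ and $V'=V$. While $|W|<k$: choose $c_*\in C\setminus W$ maximizing $\max_{1\le j\le d}|V'_{c_*[j]}|$; add $c_*$ to $W$; replace $V'$ by $V'\setminus\bigcup_{j=1}^d V_{c_*[j]}$; if $V'$ is now empty, reset $V'=V$. Output $W$. Weak unanimity of $W$: if there is $j\in\{1,\dots,d\}$ with $\bigcap_{v_i\in V}C_i^j\ne\emptyset$, then there is $j'\in\{1,\dots,d\}$ with $\left(\bigcap_{v_i\in V}C_i^{j'}\right)\cap W^{j'}\neq\emptyset$. *)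

(* Defs.v *)
From mathcomp Require Import all_boot.

Set Implicit Arguments.
Unset Strict Implicit.
Unset Printing Implicit Defensive.

Record instance := Instance {
  voter : finType;
  cand : finType;
  dim : nat;
  dom : 'I_dim -> finType;
  attr : cand -> forall j : 'I_dim, dom j;
  appr : voter -> forall j : 'I_dim, {set dom j};
  ksize : nat;
  voter_gt0 : 0 < #|voter|;
  dim_gt0 : 0 < dim;
  ksize_gt0 : 0 < ksize;
  ksize_le : ksize <= #|cand|;
  attr_onto : forall (j : 'I_dim) (x : dom j), exists c : cand, attr c j = x
}.

Section GAV.
Variable I : instance.
Implicit Types (c : cand I) (W : {set cand I}) (U : {set voter I}).

Definition committee W : Prop := #|W| = ksize I.

Definition attr_values W (j : 'I_(dim I)) : {set dom j} :=
  [set attr c j | c in W].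

(* The set U_{c[j]}. *)
Definition supporters U c (j : 'I_(dim I)) : {set voter I} :=
  [set v in U | attr c j \in appr v j].

Definition score U c : nat := \max_(j < dim I) #|supporters U c j|.

Definition gav_choice W U c : Prop :=
  c \notin W /\ forall c', c' \notin W -> score U c' <= score U c.

Definition gav_update U c : {set voter I} :=
  let U' := U :\: \bigcup_(j < dim I) supporters [set: voter I] c j in
  if U' == set0 then [set: voter I] else U'.

(* [gav_reach W U]: some way of breaking ties leads to the partial committee W
   with current voter set U (the set V' of the algorithm). *)
Inductive gav_reach : {set cand I} -> {set voter I} -> Prop :=
| gav_init : gav_reach set0 [set: voter I]
| gav_step W U c :
    gav_reach W U -> #|W| < ksize I -> gav_choice W U c ->
    gav_reach (c |: W) (gav_update U c).

Definition gav_output W : Prop :=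
  committee W /\ exists U, gav_reach W U.

Definition weak_unanimity W : Prop :=
  (exists j : 'I_(dim I), \bigcap_(v : voter I) appr v j != set0) ->
  exists j' : 'I_(dim I),
    (\bigcap_(v : voter I) appr v j') :&: attr_values W j' != set0.

End GAV.

(* Main.v *)
Require Import Defs.
From mathcomp Require Import all_boot.

(* The first choice is made with V' = V. A unanimously approved value is
   carried by some candidate, whose score is then |V|, the largest possible;
   hence the first candidate chosen also has score |V|, i.e. one of its values
   is unanimously approved, and it stays in the committee. *)

(** A subset of the voters with at least as many elements is the whole set. The form [<=] chains
    with the maximality of a greedy choice. *)
Lemma supporters_setT (I : instance) (c : cand I) (j : 'I_(dim I)) :
  (#|voter I| <= #|supporters [set: voter I] c j|) =
  (attr c j \in \bigcap_(v : voter I) appr v j).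
Proof.
rewrite -cardsT; apply/idP/bigcapP => [le_supp v _ | approved].
  have /eqP suppT : supporters [set: voter I] c j == [set: voter I].
    by rewrite eqEcard subsetT.
  by have := in_setT v; rewrite -[in X in X -> _]suppT inE => /andP[].
by apply/subset_leq_card/subsetP => v _; rewrite !inE approved.
Qed.

Lemma score_setT (I : instance) (c : cand I) :
  reflect (exists j : 'I_(dim I), attr c j \in \bigcap_(v : voter I) appr v j)
          (#|voter I| <= score [set: voter I] c).
Proof.
apply: (iffP idP) => [|[j]]; last first.
  rewrite -supporters_setT => le_supp; apply: (leq_trans le_supp).
  exact: (leq_bigmax (F := fun j => #|supporters [set: voter I] c j|)).
rewrite /score.
(* The maximum is attained at some [j] since there is at least one dimension. *)
have [|j ->] := @eq_bigmax _ (fun j => #|supporters [set: voter I] c j|).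
  by rewrite card_ord dim_gt0.
by rewrite supporters_setT => ?; exists j.
Qed.

(** Invariant of a run: the first case records that the first choice is scored against all voters;
    the second persists because [W] only grows. *)
Lemma gav_reach_unanimous (I : instance) (W : {set cand I}) (U : {set voter I}) :
  (exists j : 'I_(dim I), \bigcap_(v : voter I) appr v j != set0) ->
  gav_reach W U ->
  (W = set0 /\ U = [set: voter I]) \/
  exists2 c, c \in W &
    exists j : 'I_(dim I), attr c j \in \bigcap_(v : voter I) appr v j.
Proof.
move=> [j /set0Pn[x x_unan]]; elim=> [|{}W {}U c _ IH _ [_ c_max]]; first by left.
right; case: IH => [[W0 UT] | [c' c'W c'_unan]]; last first.
  by exists c' => //; rewrite setU1r.
exists c; first exact: setU11.
have [c0 attr_c0] := attr_onto x.
apply/score_setT; rewrite -UT; apply: leq_trans (c_max c0 _).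
  by rewrite UT; apply/score_setT; exists j; rewrite attr_c0.
by rewrite W0 inE.
Qed.

Theorem lemma9 (I : instance) (W : {set cand I}) :
  gav_output W -> weak_unanimity W.
Proof.
move=> [cardW [U reachW]] unan.
have [[W0 _] | [c cW [j c_unan]]] := gav_reach_unanimous _ _ _ unan reachW.
  (* A positive committee size excludes the initial state. *)
  by have := ksize_gt0 I; rewrite -cardW W0 cards0.
by exists j; apply/set0Pn; exists (attr c j); rewrite inE c_unan imset_f.
Qed.
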